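(* Let $\mathbb{H}$ be a complex Hilbert space and let $A,T,B\in B(\mathbb{H})$. Then for all $x\in\mathbb{H}$, $$|\langle A^*TBx,x\rangle|+|\langle B^*TAx,x\rangle|\leq 2\,w(T)\,\|Ax\|\,\|Bx\|.$$
   Context: $B(\mathbb{H})$ denotes the bounded linear operators on the complex Hilbert space $\mathbb{H}$. The numerical radius is $w(T)=\sup\{|\langle Tx,x\rangle| : x\in\mathbb{H}, \|x\|=1\}$. *)

(* Defs.v *)
From HB Require Import structures.
From mathcomp Require Import all_boot all_order all_algebra.
From mathcomp Require Import all_classical all_reals topology normedtype.
From mathcomp Require Import sesquilinear complex.
From mathcomp Require Import ring lra.

Set Implicit Arguments.
Unset Strict Implicit.
Unset Printing Implicit Defensive.

Import Order.TTheory GRing.Theory Num.Theory.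
Import numFieldNormedType.Exports.

Local Open Scope classical_set_scope.
Local Open Scope ring_scope.
Local Open Scope complex_scope.

(* {dot H for conj} is a positive definite Hermitian form, linear in its first
   argument and conjugate-linear in the second. *)
HB.mixin Record CompleteNormedModule_isHilbert (R : realType) H
    & CompleteNormedModule R[i] H := {
  inner : {dot H for @Num.conj R[i]} ;
  innerE : forall x : H, inner x x = `|x| ^+ 2
}.

#[short(type="hilbertType")]
HB.structure Definition Hilbert (R : realType) :=
  {H of CompleteNormedModule R[i] H & CompleteNormedModule_isHilbert R H}.

Notation "''[' x , y ]" := (inner x y) : ring_scope.

Record bounded_operator (R : realType) (H : hilbertType R) := BoundedOperator {
  bounded_operator_fun :> {linear H -> H} ;
  bounded_operatorP : exists M : R, forall x,
    `|bounded_operator_fun x| <= M%:C * `|x|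
}.

(* The norm of a complex number is valued in R[i]; Re reads it off as a real.
   For a bounded operator the set is bounded above; it is empty exactly when
   H = {0}, where sup returns 0. *)
Definition numerical_radius (R : realType) (H : hilbertType R)
    (T : bounded_operator H) : R :=
  sup [set complex.Re `|'[T x, x]| | x in [set x : H | `|x| = 1]].

Section InnerProduct.
Variables (R : realType) (H : hilbertType R).
Implicit Types (x y z : H) (a : R).

Let nr x : R := complex.Re `|x|.
Let rip x y : R := complex.Re '[x, y].

Let ReD (a b : R[i]) : complex.Re (a + b) = complex.Re a + complex.Re b.
Proof. by case: a; case: b. Qed.

Let ReN (a : R[i]) : complex.Re (- a) = - complex.Re a.
Proof. by case: a. Qed.

Let ReZ a (b : R[i]) : complex.Re (a%:C * b) = a * complex.Re b.
Proof. by case: b => p q /=; rewrite mul0r subr0. Qed.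

Let nrE x : `|x| = (nr x)%:C.
Proof. by rewrite /nr RRe_real// ger0_real. Qed.

Let nr_ge0 x : 0 <= nr x.
Proof. by have := normr_ge0 x; rewrite nrE lecR. Qed.

Let ripxx x : rip x x = nr x ^+ 2.
Proof. by rewrite /rip innerE nrE -rmorphXn. Qed.

Let ripDl x y z : rip (x + y) z = rip x z + rip y z.
Proof. by rewrite /rip linearDl ReD. Qed.

Let ripZl a x y : rip (a%:C *: x) y = a * rip x y.
Proof. by rewrite /rip linearZl_LR ReZ. Qed.

Let ripC x y : rip x y = rip y x.
Proof.
rewrite /rip (@hermC _ _ _ _ inner) /= expr0 mul1r; by case: (inner y x).
Qed.

Let ripDr x y z : rip z (x + y) = rip z x + rip z y.
Proof. by rewrite ripC ripDl !(ripC _ z). Qed.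

Let ripZr a x y : rip x (a%:C *: y) = a * rip x y.
Proof. by rewrite ripC ripZl ripC. Qed.

Let ripNl x y : rip (- x) y = - rip x y.
Proof. by rewrite /rip linearNl ReN. Qed.

Let ripNr x y : rip x (- y) = - rip x y.
Proof. by rewrite ripC ripNl ripC. Qed.

Lemma inner_inj x y : (forall h : H, '[h, x] = '[h, y]) -> x = y.
Proof.
move=> e; apply/eqP; rewrite -subr_eq0 -normr_eq0 -sqrf_eq0 -innerE.
by rewrite linearBr /= e subrr.
Qed.

Let rip_le x y : rip x y <= nr x * nr y.
Proof.
have [->|x0] := eqVneq x 0.
  by rewrite /rip linear0l /= mulr_ge0.
have [->|y0] := eqVneq y 0.
  by rewrite /rip linear0r /= mulr_ge0.
have nr_gt0 z : z != 0 -> 0 < nr z.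
  by move=> z0; have := normr_gt0 z; rewrite z0 nrE ltcR.
have := nr_gt0 _ x0; have := nr_gt0 _ y0.
have : 0 <= rip ((nr y)%:C *: x + (- nr x)%:C *: y)
                ((nr y)%:C *: x + (- nr x)%:C *: y) by rewrite ripxx sqr_ge0.
rewrite !(ripDl, ripDr, ripZl, ripZr) !ripxx (ripC y x).
move: (nr x) (nr y) (rip x y) => p q r e q0 p0.
have {}e : 0 <= (2 * (p * q)) * (p * q - r) by lra.
by move: e; rewrite pmulr_rge0 ?subr_ge0// !mulr_gt0.
Qed.

(* Riesz representation: the representing vector minimizes |x|^2 - 2 g(x). *)
Let riesz_real (g : H -> R) (M : R) :
  (forall x y, g (x + y) = g x + g y) ->
  (forall a x, g (a%:C *: x) = a * g x) ->
  (forall x, g x <= M * nr x) ->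
  exists z, forall h, rip h z = g h.
Proof.
move=> gD gZ gM0.
wlog M0 : M gM0 / 0 <= M.
  move=> /(_ `|M|); apply => // x; apply: le_trans (gM0 x) _.
  by rewrite ler_wpM2r// ler_norm.
have gN x : g (- x) = - g x.
  have g0 : g 0 = 0 by have := gD 0 0; rewrite addr0; lra.
  by have := gD x (- x); rewrite subrr g0; lra.
pose J x := rip x x - 2 * g x.
pose m := inf (range J).
have Jlb : has_inf (range J).
  split; first by exists (J 0), 0.
  exists (- M ^+ 2) => _ [x _ <-]; rewrite /J ripxx.
  have := gM0 x; have := sqr_ge0 (nr x - M); move: (nr x) (g x) => p q.
  by rewrite sqrrB; nra.
have mJ x : m <= J x.
  by apply: ge_inf; [exact: Jlb.2|exists x].
have Jm e : 0 < e -> exists x, J x < m + e.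
  by move=> e0; have [_ [x _ <-] ?] := inf_adherent e0 Jlb; exists x.
pose F : set_system H :=
  [set A | exists2 e, 0 < e & [set x | J x < m + e] `<=` A].
have FF : ProperFilter F.
  apply: Build_ProperFilter.
    by move=> [e e0 eA]; have [x xe] := Jm _ e0; exact: (eA x).
  split.
  - by exists 1.
  - move=> A B [e e0 eA] [d d0 dB]; exists (Num.min e d).
      by rewrite lt_min e0.
    move=> x /=; rewrite addr_minr lt_min => /andP[? ?].
    by split; [exact: eA|exact: dB].
  - by move=> A B AB [e e0 eA]; exists e => //; exact: subset_trans AB.
have Jmid x y : nr (x - y) ^+ 2 =
    2 * (J x + J y - 2 * J ((2^-1)%:C *: (x + y))).
  rewrite -ripxx /J !(ripDl, ripDr, ripZl, ripZr, ripNl, ripNr, gD, gZ).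
  rewrite (ripC y x).
  by field.
have ballP x y (e : R) : ball x e%:C y = (nr (x - y) < e) :> Prop.
  by rewrite -ball_normE /= nrE ltcR.
have Fc : cauchy F.
  apply: cauchy_exP => e; rewrite ltcE => /andP[/eqP ei er].
  have -> : e = (complex.Re e)%:C by case: e ei {er} => ? ? /= ->.
  move: (complex.Re e) er => {ei}/= {}e e0.
  have d0 : 0 < e ^+ 2 / 4 by rewrite divr_gt0// exprn_gt0.
  have [x xe] := Jm _ d0; exists x; exists (e ^+ 2 / 4) => // y /= ye.
  rewrite ballP -(@ltr_pXn2r _ 2)// ?nnegrE ?nr_ge0 ?ltW//.
  by rewrite Jmid; have := mJ ((2^-1)%:C *: (x + y)); lra.
have [z Fz] : exists z : H, F --> z by apply/cvg_ex; exact: cauchy_cvg F _ Fc.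
exists z => h.
have Jz : J z <= m.
  apply/ler_addgt0Pr => d d0.
  pose c := 1 + 2 * nr z + 2 * M.
  have c0 : 0 < c by have := nr_ge0 z; rewrite /c; lra.
  pose e := d / c; have e0 : 0 < e by rewrite divr_gt0.
  have [e1 e10 e1z] : F (ball z e%:C).
    by apply: Fz; apply: nbhsx_ballx; rewrite ltcR.
  have [x] : exists x, J x < m + Num.min e e1 by apply: Jm; rewrite lt_min e0.
  rewrite addr_minr lt_min => /andP[xe /e1z]; rewrite ballP => zx.
  have -> : d = e + (2 * nr z + 2 * M) * e.
    by rewrite -[X in X + _]mul1r -mulrDl addrA -/c /e mulrC divfK// gt_eqF.
  have JE : J z = J x + 2 * rip z (z - x) - nr (z - x) ^+ 2 + 2 * g (x - z).
    rewrite -ripxx /J !(ripDl, ripDr, ripNl, ripNr, gD, gN) (ripC x z).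
    ring.
  have nzx : nr (x - z) = nr (z - x) by rewrite /nr distrC.
  have h1 : rip z (z - x) <= nr z * e.
    by rewrite (le_trans (rip_le _ _))// ler_wpM2l// ltW.
  have h2 : g (x - z) <= M * e.
    by rewrite (le_trans (gM0 _))// nzx ler_wpM2l// ltW.
  by have := sqr_ge0 (nr (z - x)); rewrite JE; nra.
apply/eqP; rewrite -subr_eq0; apply/negPn/negP => c0.
set c := _ - _ in c0.
pose N := nr h ^+ 2 + 1.
have N0 : 0 < N by rewrite /N ltr_wpDl// sqr_ge0.
have := le_trans Jz (mJ (z + (- c / N)%:C *: h)).
rewrite /J !(ripDl, ripDr, ripZl, ripZr, gD, gZ) (ripC z h) (ripxx h).
have cE : rip h z = g h + c by rewrite /c; ring.
rewrite cE => le0.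
have {le0} : 0 <= (c / N) ^+ 2 * (nr h ^+ 2 - 2 * N).
  rewrite (_ : _ * _ = (c / N) ^+ 2 * nr h ^+ 2 - 2 * (c / N) * c); first lra.
  by field; rewrite gt_eqF.
rewrite pmulr_rge0; first by rewrite /N; have := sqr_ge0 (nr h); lra.
by rewrite exprn_even_gt0//= mulf_neq0// invr_neq0// gt_eqF.
Qed.

Lemma adjoint_exists (T : bounded_operator H) :
  exists S : bounded_operator H, forall x y, '[T x, y] = '[x, S y].
Proof.
have [M [M0 TM]] : exists M, 0 <= M /\ forall x, nr (T x) <= M * nr x.
  have [M TM] := bounded_operatorP T; exists `|M|; split=> // x.
  have := TM x; rewrite !nrE -rmorphM lecR => /le_trans; apply.
  by rewrite ler_wpM2r// ler_norm.
have ex y : exists z, forall x, '[T x, y] = '[x, z].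
  have [||x|z zP] := @riesz_real (fun x => rip (T x) y) (M * nr y).
  - by move=> u v; rewrite linearD ripDl.
  - by move=> a u; rewrite linearZ ripZl.
  - apply: le_trans (rip_le _ _) _.
    by rewrite mulrAC ler_wpM2r.
  exists z => x; apply/eqP; rewrite eq_complex; apply/andP; split.
    by rewrite -[X in X == _]zP.
  have := zP ('i *: x); rewrite /rip linearZ !linearZl_LR /=.
  case: '[x, z] => p q; case: '[T x, y] => s t /=.
  by rewrite !mul0r !mul1r !sub0r => /oppr_inj ->.
have [S SP] := choice ex.
have Slin : linear S.
  move=> a u v; apply: inner_inj => h.
  by rewrite -SP !linearPr /= !SP.
pose SL : {linear H -> H} := HB.pack S (GRing.isLinear.Build _ _ _ _ S Slin).
suff SB : exists M : R, forall x, `|SL x| <= M%:C * `|x|.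
  by exists (BoundedOperator SB) => x y; rewrite /= SP.
exists M => y; rewrite !nrE -rmorphM lecR /=.
have [->|S0] := eqVneq (nr (S y)) 0.
  by rewrite mulr_ge0.
have Sp : 0 < nr (S y) by rewrite lt_neqAle eq_sym S0 nr_ge0.
rewrite -(ler_pM2l Sp) -expr2 -ripxx /rip -SP -/(rip _ _).
apply: le_trans (rip_le _ _) _; rewrite mulrA ler_wpM2r// mulrC.
exact: TM.
Qed.

End InnerProduct.

Definition adjoint (R : realType) (H : hilbertType R) (T : bounded_operator H) :
  bounded_operator H := projT1 (cid (adjoint_exists T)).

Lemma adjointP (R : realType) (H : hilbertType R) (T : bounded_operator H) x y :
  '[T x, y] = '[x, adjoint T y].
Proof. exact: projT2 (cid (adjoint_exists T)) x y. Qed.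

Lemma adjoint_unique (R : realType) (H : hilbertType R) (T : bounded_operator H)
    (S : H -> H) :
  (forall x y, '[T x, y] = '[x, S y]) -> S =1 adjoint T.
Proof. by move=> TS y; apply: inner_inj => h; rewrite -TS adjointP. Qed.

(* Main.v *)
(* Put u = A x and v = B x, so that the left-hand side is |<T v, u>| + |<T u, v>|.
   Polarization, <T(u+v), u+v> - <T(u-v), u-v> = 2 (<T u, v> + <T v, u>), and the
   parallelogram law give |<T u, v> + <T v, u>| <= w(T) (|u|^2 + |v|^2).  Rotating
   u by a phase that aligns the two terms turns the left-hand side into a sum of
   moduli, and rescaling u and v to equal norms turns |u|^2 + |v|^2 into
   2 |u| |v|. *)

Require Import Defs.
From mathcomp Require Import all_boot all_order all_algebra.
From mathcomp Require Import all_classical all_reals topology normedtype.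
From mathcomp Require Import sesquilinear complex.
From mathcomp Require Import ring.

Import Order.TTheory GRing.Theory Num.Theory.
Import numFieldNormedType.Exports.

Local Open Scope ring_scope.
Local Open Scope complex_scope.

(** The conjugate on [b] reflects the later use: replacing [u] by [c *: u] multiplies ['[T u, v]] by
    [c] and ['[T v, u]], conjugate-linear in [u], by [Num.conj c]. *)
Lemma exists_aligning_phase {C : numClosedFieldType} (a b : C) :
  exists2 c : C, `|c| = 1 & `|c * a + Num.conj c * b| = `|a| + `|b|.
Proof.
have [->|a0] := eqVneq a 0.
  by exists 1; rewrite ?normr1// rmorph1 !mul1r normr0 !add0r.
have [->|b0] := eqVneq b 0.
  by exists 1; rewrite ?normr1// rmorph1 !mul1r normr0 !addr0.
(* [c ^+ 2] is the quotient of the phases of [b] and [a]. *)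
pose c := sqrtC (b / `|b| / (a / `|a|)).
have cc : c ^+ 2 = b / `|b| / (a / `|a|) by rewrite sqrtCK.
have na : `|a| != 0 by rewrite normr_eq0.
have nb : `|b| != 0 by rewrite normr_eq0.
have c1 : `|c| = 1.
  apply/eqP; rewrite -(@pexpr_eq1 _ _ 2)// -normrX cc !(normrM, normfV, normr_id).
  by rewrite !divff// ?oner_neq0.
have c0 : c != 0 by rewrite -normr_eq0 c1 oner_neq0.
exists c => //.
have -> : Num.conj c = c^-1 by rewrite invC_norm c1 expr1n invr1 mul1r.
(* With this [c], both terms are nonnegative real multiples of [c^-1 * b], so their moduli add. *)
have -> : c * a + c^-1 * b = c^-1 * b * ((`|a| + `|b|) / `|b|).
  have -> : c * a = c^-1 * (c ^+ 2 * a) by rewrite expr2 !mulrA mulVf// mul1r.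
  by rewrite cc; field; rewrite a0 na nb c0.
rewrite !normrM !normfV normr_id c1 invr1 mul1r mulrC divfK//.
by rewrite ger0_norm// addr_ge0.
Qed.

Section NumericalRadius.
Variables (R : realType) (H : hilbertType R) (T : bounded_operator H).
Implicit Types u v x : H.

Lemma norm_inner_le u v : `|'[u, v]| <= `|u| * `|v|.
Proof.
have [->|v0] := eqVneq v 0; first by rewrite linear0r !normr0 mulr0.
have v_gt0 : 0 < '[v, v] by rewrite innerE exprn_gt0// normr_gt0.
have vJ : Num.conj '[v, v] = '[v, v] by rewrite geC0_conj// ltW.
(* Cauchy-Schwarz: this vector is ['[v, v]] times the component of [u] orthogonal to [v], which
   avoids division. *)
have : 0 <= '[ '[v, v] *: u - '[u, v] *: v, '[v, v] *: u - '[u, v] *: v].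
  by rewrite innerE exprn_ge0.
rewrite linearBl !linearBr /= !linearZl_LR /= !linearZr_LR /= vJ.
rewrite (@hermC _ _ _ _ inner v u) /= expr0 mul1r.
rewrite (_ : _ - _ = '[v, v] * ('[u, u] * '[v, v] - '[u, v] * Num.conj '[u, v]));
  last by ring.
rewrite pmulr_rge0// subr_ge0 -normCK !innerE -exprMn.
by rewrite ler_pXn2r// nnegrE// mulr_ge0.
Qed.

Lemma norm_inner_le_numerical_radius x :
  `|'[T x, x]| <= (numerical_radius T)%:C * `|x| ^+ 2.
Proof.
have [->|x0] := eqVneq x 0.
  by rewrite linear0r !normr0 expr0n mulr0.
have nx0 : `|x| != 0 by rewrite normr_eq0.
pose e := `|x|^-1 *: x.
have e1 : `|e| = 1 by rewrite normrZ normfV normr_id mulVf.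
have -> : x = `|x| *: e by rewrite scalerA divff// scale1r.
clearbody e.
rewrite linearZr_LR /= [T _]linearZ linearZl_LR /= [in leRHS]normrZ e1 mulr1.
rewrite !normrM norm_conjC !normr_id mulrA -expr2 mulrC ler_wpM2r ?exprn_ge0//.
rewrite -[leLHS]RRe_real ?ger0_real// lecR.
apply: ub_le_sup; last by exists e.
(* The supremum dominates its members only if the set is bounded above; on unit vectors,
   Cauchy-Schwarz and the operator bound give [M]. *)
have [M TM] := bounded_operatorP T; exists M => _ [y y1 <-].
rewrite /= in y1.
rewrite -lecR RRe_real ?ger0_real//.
by rewrite (le_trans (norm_inner_le _ _))// y1 mulr1 (le_trans (TM y))// y1 mulr1.
Qed.

Lemma parallelogram u v :
  `|u + v| ^+ 2 + `|u - v| ^+ 2 = 2 * (`|u| ^+ 2 + `|v| ^+ 2).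
Proof. by rewrite -!innerE linearBl !linearDl linearBr /= !linearDr; ring. Qed.

Lemma norm_sum_inner_le_numerical_radius u v :
  `|'[T u, v] + '[T v, u]| <=
    (numerical_radius T)%:C * (`|u| ^+ 2 + `|v| ^+ 2).
Proof.
rewrite -(@ler_pM2l _ 2)// mulrCA -parallelogram mulrDr.
rewrite -[X in X * `|_|]normr_nat -normrM.
have -> : 2 * ('[T u, v] + '[T v, u]) =
    '[T (u + v), u + v] - '[T (u - v), u - v].
  by rewrite [T (u + v)]linearD [T (u - v)]linearB linearBl !linearDl /= !linearBr !linearDr; ring.
by rewrite (le_trans (ler_normB _ _))// lerD// norm_inner_le_numerical_radius.
Qed.

Lemma sum_norm_inner_le_numerical_radius u v :
  `|'[T u, v]| + `|'[T v, u]| <=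
    (numerical_radius T)%:C * (`|u| ^+ 2 + `|v| ^+ 2).
Proof.
have [c c1 <-] := exists_aligning_phase '[T u, v] '[T v, u].
have := norm_sum_inner_le_numerical_radius (c *: u) v.
by rewrite linearZr_LR /= [T _]linearZ linearZl_LR /= normrZ c1 mul1r.
Qed.

Lemma sum_norm_inner_le_mul_norm u v :
  `|'[T u, v]| + `|'[T v, u]| <=
    2 * (numerical_radius T)%:C * `|u| * `|v|.
Proof.
have [->|u0] := eqVneq u 0.
  by rewrite [T 0]linear0 linear0l linear0r !normr0 addr0 mulr0 mul0r.
have [->|v0] := eqVneq v 0.
  by rewrite [T 0]linear0 linear0l linear0r !normr0 addr0 mulr0.
have uv0 : 0 < `|u| * `|v| by rewrite mulr_gt0 ?normr_gt0.
(* Both rescaled vectors have norm [|u| |v|]. The left side gains one factor [|u| |v|] and the right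
   side becomes [2 w(T) (|u| |v|)^2], so one factor cancels. *)
have := sum_norm_inner_le_numerical_radius (`|v| *: u) (`|u| *: v).
rewrite !linearZr_LR /= ![T _]linearZ !linearZl_LR /= ![in leRHS]normrZ !normrM !norm_conjC.
rewrite !normr_id => le_uv; rewrite -(ler_pM2l uv0).
rewrite [leLHS](_ : _ = `|u| * (`|v| * `|'[T u, v]|) +
  `|v| * (`|u| * `|'[T v, u]|)); last by ring.
by apply: le_trans le_uv _; rewrite le_eqVlt; apply/orP; left; apply/eqP; ring.
Qed.

Lemma inner_adjointl u v : '[adjoint T u, v] = '[u, T v].
Proof.
by rewrite (@hermC _ _ _ _ inner) /= -adjointP (@hermC _ _ _ _ inner u) /=.
Qed.

End NumericalRadius.

Theorem lemma2p2 (R : realType) (H : hilbertType R)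
    (A T B : bounded_operator H) (x : H) :
  `|'[(adjoint A \o T \o B) x, x]| + `|'[(adjoint B \o T \o A) x, x]|
    <= 2 * (numerical_radius T)%:C * `|A x| * `|B x|.
Proof.
(* Moving the adjoints across leaves ['[T (B x), A x]] and ['[T (A x), B x]]; the swap matches
   [u = A x], [v = B x]. *)
by rewrite /= !inner_adjointl addrC sum_norm_inner_le_mul_norm.
Qed.
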